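(* Assume that $X$ and $Y:=\operatorname{dom}F^*$ are compact, and that $B=I$ (so $\mathcal W=\mathcal Y$), $b=0$. Let $\rho>0$. In the AADMM algorithm (described in the context), if the parameters are set to $\alpha_t\equiv1$, $\theta_t\equiv\tau_t\equiv\rho_t\equiv\rho$ and $\eta_t\equiv L_G+\chi\rho\|K\|^2$, then $$G(x^{t+1})+F(Kx^{t+1})-f^*\le\frac{L_G}{2t}D_X^2+\frac{\chi\rho}{2t}\|K\|^2D_X^2+\frac{(1-\chi)\rho}{2t}D_{X,K}^2+\frac{D_Y^2}{2\rho t},$$ where $x^{t+1}:=\frac1t\sum_{i=2}^{t+1}x_i$. In particular, if $\rho$ is given by $\rho=\dfrac{D_Y}{\chi\|K\|D_X+(1-\chi)D_{X,K}}$, then $$G(x^{t+1})+F(Kx^{t+1})-f^*\le\frac{L_GD_X^2}{2t}+\frac{\chi\|K\|D_XD_Y+(1-\chi)D_{X,K}D_Y}{t}.$$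
   Context: $\mathcal W,\mathcal X,\mathcal Y$ are finite-dimensional vector spaces equipped with inner product $\langle\cdot,\cdot\rangle$, norm $\|\cdot\|$ and conjugate norm $\|\cdot\|_*$; $X\subseteq\mathcal X$ is a closed convex set; $G:X\to\mathbb R$ and $F:\mathcal W\to\mathbb R$ are finite-valued, convex and lower semicontinuous; $F^*(u)=\sup_{w}\langle u,w\rangle-F(w)$ is the convex conjugate of $F$ and $\operatorname{dom}F^*=\{u:F^*(u)<\infty\}$; $K:\mathcal X\to\mathcal Y$ and $B:\mathcal W\to\mathcal Y$ are bounded linear operators, $\|K\|$ is the operator norm; $b\in\mathcal Y$. $G$ is continuously differentiable and there is $L_G>0$ with $G(x_2)-G(x_1)-\langle\nabla G(x_1),x_2-x_1\rangle\le\frac{L_G}{2}\|x_2-x_1\|^2$ for all $x_1,x_2\in X$. Problem: minimize $G(x)+F(w)$ over $x\in X$, $w\in\mathcal W$ subject to $Bw-Kx=b$ (when $B=I,b=0$ this is $\min_{x\in X}G(x)+F(Kx)$). It is assumed that there is an optimal solution $(w^*,x^* )$ and $y^*\in\mathcal Y$ such that $(w^*,x^*,y^* )$ is a saddle point of $\min_{x\in X,w\in\mathcal W}\max_{y\in\mathcal Y}G(x)+F(w)-\langle y,Bw-Kx-b\rangle$. $f^*:=G(x^* )+F(w^* )$ is the optimal value. Constants: $D_S:=\sup_{s_1,s_2\in S}\|s_1-s_2\|$ for a compact set $S$; $D_{X,K}:=\sup_{u_1,u_2\in X}\|Ku_1-Ku_2\|$. AADMM algorithm. $\chi\in\{0,1\}$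 is a binary constant; $\alpha_t,\theta_t,\tau_t,\rho_t,\eta_t$ are parameters. Choose $x_1\in X$, $w_1\in\mathcal W$ with $Bw_1=Kx_1+b$; set $x_1^{ag}=x_1$, $w_1^{ag}=w_1$, $y_1^{ag}=y_1=0$. For $t=1,\dots,N-1$: $$\begin{aligned}x_t^{md}&=(1-\alpha_t)x_t^{ag}+\alpha_tx_t,\\ x_{t+1}&=\operatorname*{argmin}_{x\in X}\ \langle\nabla G(x_t^{md}),x\rangle-\chi\theta_t\langle Bw_t-Kx_t-b,Kx\rangle+\tfrac{(1-\chi)\theta_t}2\|Bw_t-Kx-b\|^2+\langle y_t,Kx\rangle+\tfrac{\eta_t}2\|x-x_t\|^2,\\ x_{t+1}^{ag}&=(1-\alpha_t)x_t^{ag}+\alpha_tx_{t+1},\\ w_{t+1}&=\operatorname*{argmin}_{w\in\mathcal W}\ F(w)-\langle y_t,Bw\rangle+\tfrac{\tau_t}2\|Bw-Kx_{t+1}-b\|^2,\\ w_{t+1}^{ag}&=(1-\alpha_t)w_t^{ag}+\alpha_tw_{t+1},\\ y_{t+1}&=y_t-\rho_t(Bw_{t+1}-Kx_{t+1}-b),\\ y_{t+1}^{ag}&=(1-\alpha_t)y_t^{ag}+\alpha_ty_{t+1}.\end{aligned}$$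
   Formalization: The formal theorem additionally assumes that the initial dual iterate y_1 = 0 lies in Y = dom F^* (without this the printed bound fails, e.g. for F linear and nonzero), and takes the norms to be those induced by the inner products. *)

(* Defs.v *)
From HB Require Import structures.
From mathcomp Require Import all_boot all_order all_algebra.
From mathcomp Require Import all_classical all_reals all_analysis.
Import numFieldNormedType.Exports.

Set Implicit Arguments.
Unset Strict Implicit.
Unset Printing Implicit Defensive.

Import Order.TTheory GRing.Theory Num.Theory.

Local Open Scope classical_set_scope.
Local Open Scope ring_scope.

(* Finite-dimensional real inner product spaces; the norm (hence the topology)
   is the one induced by the inner product, so it is its own dual norm. *)
HB.mixin Record NormedModule_isEuclidean (R : realType) V
    of NormedModule R V := {
  inner : {dot V for idfun} ;
  norm_inner : forall x : V, `|x| ^+ 2 = inner x x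
}.

#[short(type="euclideanType")]
HB.structure Definition Euclidean (R : realType) :=
  {V of NormedModule_isEuclidean R V & NormedModule R V & Vector R V}.

Arguments inner {R s}.

Definition is_argmin (T : Type) (R : realType) (D : set T) (f : T -> R) (z : T)
  : Prop := D z /\ forall z', D z' -> f z <= f z'.

(* `gradG` is only required to be a gradient relative to `X`: `G` is a
   function on `X`, and its values outside of `X` are irrelevant. *)
Definition gradient_on (R : realType) (V : euclideanType R) (X : set V)
    (G : V -> R) (gradG : V -> V) : Prop :=
  forall x, X x -> forall e : R, 0 < e ->
    \forall z \near within X (nbhs x),
      `|G z - G x - inner (gradG x) (z - x)| <= e * `|z - x|.

(* `subspace X` carries the topology induced on `X`, points outside of `X`
   being isolated. *)
Definition lower_semicontinuous_on (R : realType) (V : euclideanType R)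
    (X : set V) (G : V -> R) : Prop :=
  lower_semicontinuous (fun x : subspace X => (G x)%:E).

Definition convex_conj (R : realType) (V : euclideanType R) (F : V -> R)
    (u : V) : \bar R :=
  ereal_sup [set (inner u w - F w)%:E | w in [set: V]].

Definition dom_conj (R : realType) (V : euclideanType R) (F : V -> R) : set V :=
  [set u | (convex_conj F u < +oo)%E].

Definition opnorm (R : realType) (U V : normedModType R) (K : U -> V) : R :=
  sup [set `|K x| | x in [set x : U | `|x| <= 1]].

Definition diam (R : realType) (V : normedModType R) (S : set V) : R :=
  sup [set `|s1 - s2| | s1 in S & s2 in S].

Definition diam_under (R : realType) (U V : normedModType R) (K : U -> V)
    (X : set U) : R :=
  sup [set `|K u1 - K u2| | u1 in X & u2 in X].

Section Problem.
Context {R : realType} {W U V : euclideanType R}.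
Variables (X : set U) (G : U -> R) (F : W -> R) (K : U -> V) (B : W -> V)
  (b : V).

Definition feasible (w : W) (x : U) : Prop := X x /\ B w - K x = b.

Definition is_optimal (w : W) (x : U) : Prop :=
  feasible w x /\ forall w' x', feasible w' x' -> G x + F w <= G x' + F w'.

Definition lagrangian (w : W) (x : U) (y : V) : R :=
  G x + F w - inner y (B w - K x - b).

Definition is_saddle_point (w : W) (x : U) (y : V) : Prop :=
  [/\ X x,
      forall y', lagrangian w x y' <= lagrangian w x y
    & forall w' x', X x' -> lagrangian w x y <= lagrangian w' x' y].

Record is_AADMM (gradG : U -> U) (chi : bool) (alpha theta tau rho eta : nat -> R)
    (N : nat) (x xag xmd : nat -> U) (w wag : nat -> W) (y yag : nat -> V)
    : Prop := {
  AADMM_x1 : X (x 1) ;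
  AADMM_w1 : B (w 1) = K (x 1) + b ;
  AADMM_xag1 : xag 1 = x 1 ;
  AADMM_wag1 : wag 1 = w 1 ;
  AADMM_y1 : y 1 = 0 ;
  AADMM_yag1 : yag 1 = y 1 ;
  AADMM_xmd : forall t, (1 <= t < N)%N ->
    xmd t = (1 - alpha t) *: xag t + alpha t *: x t ;
  AADMM_x : forall t, (1 <= t < N)%N ->
    is_argmin X
      (fun z => inner (gradG (xmd t)) z
         - chi%:R * theta t * inner (B (w t) - K (x t) - b) (K z)
         + (1 - chi%:R) * theta t / 2 * `|B (w t) - K z - b| ^+ 2
         + inner (y t) (K z)
         + eta t / 2 * `|z - x t| ^+ 2)
      (x t.+1) ;
  AADMM_xag : forall t, (1 <= t < N)%N ->
    xag t.+1 = (1 - alpha t) *: xag t + alpha t *: x t.+1 ;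
  AADMM_w : forall t, (1 <= t < N)%N ->
    is_argmin [set: W]
      (fun v => F v - inner (y t) (B v)
         + tau t / 2 * `|B v - K (x t.+1) - b| ^+ 2)
      (w t.+1) ;
  AADMM_wag : forall t, (1 <= t < N)%N ->
    wag t.+1 = (1 - alpha t) *: wag t + alpha t *: w t.+1 ;
  AADMM_y : forall t, (1 <= t < N)%N ->
    y t.+1 = y t - rho t *: (B (w t.+1) - K (x t.+1) - b) ;
  AADMM_yag : forall t, (1 <= t < N)%N ->
    yag t.+1 = (1 - alpha t) *: yag t + alpha t *: y t.+1
}.

End Problem.

Definition ergodic_mean (R : realType) (V : normedModType R) (x : nat -> V)
    (t : nat) : V :=
  t%:R^-1 *: \sum_(2 <= i < t.+2) x i.

(* Main.v *)
Require Import Defs.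
From mathcomp Require Import all_boot all_order all_algebra.
From mathcomp Require Import all_classical all_reals all_analysis.
From mathcomp Require Import ring lra.
Import Order.TTheory GRing.Theory Num.Theory.
Import numFieldNormedType.Exports.
Local Open Scope classical_set_scope.
Local Open Scope ring_scope.

Set Implicit Arguments.
Unset Strict Implicit.
Unset Printing Implicit Defensive.

(** The method has a Lyapunov function. Let [u] be any multiplier. The
    optimality conditions of the two subproblems, the descent inequality for
    [G] and convexity bound the Lagrangian gap of the new iterate,
    [G x + F w - inner u (w - K x) - fs], by the decrease of an energy made of
    the squared distances of [x], [w] to the solution and of [y] to [u]
    ([energy_descent], [AADMM_descent]). Two observations make the bookkeeping
    work: the dual update turns the optimality condition of the [w] subproblem
    into the statement that [y t.+1] is a subgradient of [F] at [w t.+1], and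
    the weight [LG + chi * rho * opnorm K ^+ 2] of the proximal term is just
    enough to absorb the curvature of [G] and, for [chi = 1], the linearization
    of the penalty. As the energy is nonnegative, the gaps sum to at most the
    initial energy ([AADMM_sum]).

    It remains to pass from Lagrangian gaps of the iterates to the objective at
    the mean [xbar], where [w] has been replaced by [K xbar]. For this [u] is
    chosen as a subgradient of [F] at [K xbar]. It exists because [F] is finite
    and convex ([subgradient_exists], a Hahn-Banach argument by induction on
    dimension), it belongs to the domain of the conjugate
    ([subgradient_dom_conj]), and with this choice the objective gap at the
    mean is at most the mean of the Lagrangian gaps ([gap_le_mean_gap]).
    Finally the initial energy is bounded by the diameters, because
    [w 1 = K (x 1)] and because [y 1] and [u] both lie in the domain of the
    conjugate. The second
    estimate is the first one at the value of [rho] that balances its two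
    [rho]-dependent parts. *)

(** * Inner products and segments *)

Section Inner.
Context {R : realType} {V : euclideanType R}.
Implicit Types (u v w : V) (a : R).

Lemma innerC u v : inner u v = inner v u.
Proof. by rewrite (hermC (inner : {dot V for idfun}) u v) expr0 mul1r. Qed.

Lemma innerDl u v w : inner (u + v) w = inner u w + inner v w.
Proof. exact: linearDl. Qed.

Lemma innerDr u v w : inner w (u + v) = inner w u + inner w v.
Proof. exact: linearDr. Qed.

Lemma innerNl u w : inner (- u) w = - inner u w.
Proof. exact: linearNl. Qed.

Lemma innerNr u w : inner w (- u) = - inner w u.
Proof. exact: linearNr. Qed.

Lemma innerZl a u w : inner (a *: u) w = a * inner u w.
Proof. exact: linearZl_LR. Qed.

Lemma innerZr a u w : inner w (a *: u) = a * inner w u.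
Proof. exact: linearZr_LR. Qed.

Lemma inner0l w : inner 0 w = 0.
Proof. exact: linear0l. Qed.

Lemma inner_suml (I : Type) (r : seq I) (E : I -> V) w :
  inner (\sum_(i <- r) E i) w = \sum_(i <- r) inner (E i) w.
Proof.
by elim/big_rec2: _ => [|i y z _ <-]; rewrite ?inner0l ?innerDl.
Qed.

Definition innerE := (innerDl, innerDr, innerNl, innerNr, innerZl, innerZr).

Lemma inner_gt0 u : u != 0 -> 0 < inner u u.
Proof. exact: neq0_dnorm_gt0. Qed.

Lemma normD_sq u v : `|u + v| ^+ 2 = `|u| ^+ 2 + 2 * inner u v + `|v| ^+ 2.
Proof. rewrite !norm_inner !innerE (innerC v u); ring. Qed.

Lemma convex_ineq (X : set V) (f : V -> R) :
  convex_function (X : set (convex_lmodType V)) f ->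
  forall x y s, X x -> X y -> 0 <= s <= 1 ->
  f (x + s *: (y - x)) <= f x + s * (f y - f x).
Proof.
move=> cf x y s Xx Xy /andP[s0 s1].
have := cf (Itv01 s0 s1) y x (mem_set Xy) (mem_set Xx).
rewrite convRE /conv/= /unstable.onem.
have -> : s *: y + (1 - s) *: x = x + s *: (y - x).
  by rewrite scalerBl scale1r scalerBr addrCA.
move=> /le_trans; apply; rewrite le_eqVlt; apply/orP; left; apply/eqP; rewrite /=; ring.
Qed.

Lemma convex_mem (X : set V) :
  convex_set (X : set (convex_lmodType V)) ->
  forall x y s, X x -> X y -> 0 <= s <= 1 -> X (x + s *: (y - x)).
Proof.
move=> cX x y s Xx Xy /andP[s0 s1].
have := cX y x (Itv01 s0 s1) (mem_set Xy) (mem_set Xx).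
rewrite /conv/= /unstable.onem => /set_mem.
have -> : s *: y + (1 - s) *: x = x + s *: (y - x).
  by rewrite scalerBl scale1r scalerBr addrCA.
by [].
Qed.

End Inner.

(** * Subgradients of finite convex functions *)

Section Minorant.
Context {R : realType} {V : euclideanType R}.

(** Supplies the induction on dimension for [minorant_on]: the hyperplane of
    [E] orthogonal to [e] is smaller, and since it is orthogonal the inner
    product by a vector can be corrected along [e] without changing its values
    there. *)
Lemma orthogonal_split (E : {vspace V}) (e : V) : e \in E -> e != 0 ->
  exists2 E' : {vspace V}, (\dim E' < \dim E)%N &
    forall v, v \in E ->
      inner e (v - (inner e v / inner e e) *: e) = 0 /\
      v - (inner e v / inner e e) *: e \in E'.
Proof.
move=> eE e0; have ee := inner_gt0 e0.
pose E' := (E :&: orthov (inner : {dot V for idfun}) <[e]>)%VS.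
exists E'.
  rewrite ltn_neqAle dimvS ?capvSl// andbT.
  apply/negP => /eqP E'E.
  have : (E' == E)%VS by rewrite eqEdim capvSl E'E leqnn.
  move=> /eqP E'E2; move: eE; rewrite -E'E2 memv_cap mem_orthov1.
  by move=> /andP[_ /eqP ee0]; move: ee; rewrite ee0 ltxx.
move=> v vE.
have o : inner e (v - (inner e v / inner e e) *: e) = 0.
  by rewrite !innerE divfK ?subrr// gt_eqF.
split=> //; rewrite memv_cap mem_orthov1 memvB ?memvZ//=.
by apply/eqP; rewrite -[RHS]o innerC.
Qed.

Variable p : V -> R.
Hypothesis p_convex : forall x y s, 0 <= s <= 1 ->
  p (x + s *: (y - x)) <= p x + s * (p y - p x).

(** One-dimensional extension, as in the Hahn-Banach theorem: the slope [s]
    along [e] must lie above every backward difference quotient and below every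
    forward one. Convexity at the point where the segment from [u - r *: e] to
    [v + t *: e] crosses [E] says that each backward quotient is at most each
    forward one, so the supremum of the backward ones is a valid slope. *)
Lemma minorant_step (E : {vspace V}) (y e : V) :
  (forall v, v \in E -> inner y v <= p v) ->
  exists s, forall v t, v \in E -> inner y v + t * s <= p (v + t *: e).
Proof.
move=> yp.
have key u v r t : u \in E -> v \in E -> 0 < r -> 0 < t ->
    (inner y u - p (u - r *: e)) / r <= (p (v + t *: e) - inner y v) / t.
  move=> uE vE r0 t0; have tr0 : 0 < t + r by rewrite addr_gt0.
  have l01 : 0 <= r / (t + r) <= 1.
    rewrite divr_ge0 ?(ltW r0) ?(ltW tr0)//=.
    by rewrite ler_pdivrMr// mul1r lerDr ltW.
  have := p_convex (u - r *: e) (v + t *: e) l01.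
  have -> : u - r *: e + r / (t + r) *: (v + t *: e - (u - r *: e)) =
            u + r / (t + r) *: (v - u).
    have -> : v + t *: e - (u - r *: e) = (v - u) + (t + r) *: e.
      by rewrite opprB [r *: e - u]addrC addrACA scalerDl.
    by rewrite [X in _ + X = _]scalerDr scalerA divfK ?gt_eqF// addrACA addNr addr0.
  move=> H; have uvE : u + r / (t + r) *: (v - u) \in E.
    by rewrite memvD// memvZ// memvB.
  have := le_trans (yp _ uvE) H; rewrite !innerE.
  set a := inner y u; set b := inner y v; set c := p _; set d := p _.
  move=> acbd; rewrite ler_pdivrMr// mulrAC ler_pdivlMr//.
  move: acbd; rewrite -(ler_pM2r tr0).
  have -> : (a + r / (t + r) * (b - a)) * (t + r) = a * t + b * r.
    by field; rewrite gt_eqF.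
  have -> : (c + r / (t + r) * (d - c)) * (t + r) = c * t + d * r.
    by field; rewrite gt_eqF.
  by lra.
pose A := [set z : R | exists u r, [/\ u \in E, 0 < r &
  z = (inner y u - p (u - r *: e)) / r]].
have supA : has_sup A.
  split; first by exists ((inner y 0 - p (0 - 1 *: e)) / 1), 0, 1; rewrite mem0v.
  exists ((p (0 + 1 *: e) - inner y 0) / 1) => _ [u [r [uE r0 ->]]].
  by apply: key; rewrite ?mem0v.
exists (sup A) => v t vE; have [t0|t0|->] := ltgtP t 0.
- have : (inner y v - p (v + t *: e)) / - t <= sup A.
    apply: sup_upper_bound => //; exists v, (- t); split => //.
      by rewrite oppr_gt0.
    by rewrite scaleNr opprK.
  by rewrite ler_pdivrMr ?oppr_gt0//; lra.
- have : sup A <= (p (v + t *: e) - inner y v) / t.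
    apply: sup_le_ub; first by case: supA.
    by move=> _ [u [r [uE r0 ->]]]; exact: key.
  by rewrite ler_pdivlMr//; lra.
- by rewrite scale0r addr0 mul0r addr0 yp.
Qed.

(** Working with inner products by vectors throughout, rather than with abstract
    linear forms, avoids an appeal to the Riesz representation afterwards. *)
Lemma minorant_on (E : {vspace V}) : 0 <= p 0 ->
  exists y, forall v, v \in E -> inner y v <= p v.
Proof.
move=> p0; have [n] := ubnP (\dim E); elim: n E => // n IH E.
rewrite ltnS => dE; have [E0|E0] := eqVneq E 0%VS.
  exists 0 => v; rewrite E0 memv0 => /eqP ->.
  by rewrite inner0l.
have [e0 eE] : vpick E != 0 /\ vpick E \in E by rewrite vpick0 memv_pick.
move: (vpick E) e0 eE => e e0 eE; have ee := inner_gt0 e0.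
have [E' dE' splitE] := orthogonal_split eE e0.
have [y yE'] := IH E' (leq_trans dE' dE).
have [s sE'] := minorant_step e yE'.
(* the multiple of [e] is the one that gives [e] the value [s] *)
exists (y + ((s - inner y e) / inner e e) *: e) => v vE.
have [ev' v'E] := splitE v vE.
move: ev' v'E; move: (inner e v / inner e e) => c.
have -> : v = (v - c *: e) + c *: e by rewrite subrK.
rewrite addrK; move: (v - c *: e) => v' ev' v'E.
apply: le_trans (sE' v' c v'E).
rewrite !innerE ev'.
rewrite le_eqVlt; apply/orP; left; apply/eqP.
by field; rewrite gt_eqF.
Qed.

End Minorant.

(** An inner product below [fun v => F (z + v) - F z], which vanishes at [0], is
    a subgradient at [z]. *)
Lemma subgradient_exists (R : realType) (V : euclideanType R) (F : V -> R)
    (z : V) : convex_function [set: convex_lmodType V] F ->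
  exists y, forall v, F z + inner y (v - z) <= F v.
Proof.
move=> /convex_ineq cF; pose p v := F (z + v) - F z.
have [||y yp] := @minorant_on _ _ p _ fullv.
- move=> x y s s01; rewrite /p.
  have := cF (z + x) (z + y) s I I s01.
  rewrite (_ : z + y - (z + x) = y - x); last by rewrite opprD addrACA subrr add0r.
  rewrite -addrA.
  lra.
- by rewrite /p addr0 subrr.
exists y => v; have := yp (v - z) (memvf _).
by rewrite /p (addrC z) subrK; lra.
Qed.

(** * First-order optimality and gradients *)

Section FirstOrder.
Context {R : realType} {V : euclideanType R}.

Lemma ge0_of_quadratic (a c : R) :
  (forall s, 0 < s <= 1 -> 0 <= s * a + s ^+ 2 * c) -> 0 <= a.
Proof.
move=> H; rewrite leNgt; apply/negP => a0.
have ca : 0 < `|c| - a by rewrite ltr_wpDl// oppr_gt0.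
(* small enough for the linear term to dominate the quadratic one *)
pose s := - a / (2 * (`|c| - a)).
have sE : s * (`|c| - a) = - a / 2 by rewrite /s; field; rewrite gt_eqF.
have s0 : 0 < s by rewrite divr_gt0 ?oppr_gt0// mulr_gt0.
have s1 : s <= 1.
  rewrite ler_pdivrMr ?mulr_gt0// mul1r.
  by have := normr_ge0 c; lra.
have := H s; rewrite s0 s1 => /(_ isT).
rewrite expr2 -mulrA -mulrDr pmulr_rge0//.
have : s * c <= s * `|c| by rewrite ler_wpM2l ?(ltW s0)// ler_norm.
have : 0 < s * - a by rewrite mulr_gt0// oppr_gt0.
lra.
Qed.

(** Stated with a quadratic upper bound along the segment instead of a
    derivative, so that it covers both subproblems of the algorithm: the smooth
    one, where the bound is an equality, and the one with the merely convex
    summand [F], where it comes from convexity. *)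
Lemma argmin_variational (X : set V) (phi : V -> R) (p z : V) (l c : R) :
  convex_set (X : set (convex_lmodType V)) -> is_argmin X phi p -> X z ->
  (forall s, 0 <= s <= 1 ->
    phi (p + s *: (z - p)) <= phi p + s * l + s ^+ 2 * c) ->
  0 <= l.
Proof.
move=> cX [Xp minp] Xz phiq; apply: (@ge0_of_quadratic _ c) => s /andP[s0 s1].
have s01 : 0 <= s <= 1 by rewrite (ltW s0).
have := le_trans (minp _ (convex_mem cX Xp Xz s01)) (phiq s s01).
lra.
Qed.

(** The gradient is relative to [X], but [X] contains the segment from [x] to
    [z], and the inequality only needs the first-order expansion along it. *)
Lemma gradient_ineq (X : set V) (G : V -> R) (gradG : V -> V) :
  convex_set (X : set (convex_lmodType V)) ->
  convex_function (X : set (convex_lmodType V)) G ->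
  gradient_on X G gradG ->
  forall x z, X x -> X z -> G x + inner (gradG x) (z - x) <= G z.
Proof.
move=> cX cG gG x z Xx Xz; apply/ler_addgt0Pr => e e0.
set d := z - x; set g := gradG x.
have d1 : 0 < `|d| + 1 by rewrite ltr_wpDl.
have /nbhs_ballP[/= r r0 rG] := gG x Xx (e / (`|d| + 1)) (divr_gt0 e0 d1).
pose s := Num.min 1 (r / (2 * (`|d| + 1))).
have s0 : 0 < s by rewrite lt_min ltr01 divr_gt0// mulr_gt0.
have s1 : s <= 1 by rewrite ge_min lexx.
have s01 : 0 <= s <= 1 by rewrite (ltW s0).
have sr : s * `|d| < r.
  apply: (@le_lt_trans _ _ (r / (2 * (`|d| + 1)) * (`|d| + 1))).
    by apply: ler_pM => //; [exact: ltW|rewrite ge_min lexx orbT|rewrite lerDl].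
  have -> : r / (2 * (`|d| + 1)) * (`|d| + 1) = r / 2 by field; rewrite gt_eqF.
  by move: r0; rewrite /=; lra.
have xs : ball x r (x + s *: d).
  by rewrite -ball_normE /= opprD addNKr normrN normrZ gtr0_norm.
have := rG _ xs (convex_mem cX Xx Xz s01).
rewrite (_ : x + s *: d - x = s *: d); last by rewrite addrC addKr.
rewrite innerZr normrZ (gtr0_norm s0) -/g ler_norml => /andP[H _].
have cGx := convex_ineq cG Xx Xz s01; rewrite -/d in cGx.
have sd : e / (`|d| + 1) * (s * `|d|) <= s * e.
  rewrite mulrCA ler_wpM2l ?(ltW s0)// mulrAC ler_pdivrMr// ler_wpM2l ?(ltW e0)//.
  by rewrite lerDl.
have : 0 <= s * (G z + e - (G x + inner g d)).
  lra.
by rewrite pmulr_rge0// subr_ge0.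
Qed.

End FirstOrder.

(** * Operator norm and diameters *)

Section Bounds.
Context {R : realType} {U V : normedModType R}.

Lemma opnorm_ub (K : {linear U -> V}) : bounded_near K (nbhs (0 : U)) ->
  forall v, `|K v| <= opnorm K * `|v|.
Proof.
move=> /linear_boundedP /pinfty_ex_gt0 [M M0 KM] v.
have [->|v0] := eqVneq v 0; first by rewrite linear0 !normr0 mulr0.
have nv : 0 < `|v| by rewrite normr_gt0.
rewrite -ler_pdivrMr//.
have -> : `|K v| / `|v| = `|K (`|v|^-1 *: v)|.
  by rewrite linearZ normrZ normfV normr_id mulrC.
apply: sup_upper_bound.
  split; first by exists `|K 0|, 0 => //=; rewrite normr0.
  exists M => _ [u /= u1 <-]; apply: le_trans (KM u) _.
  by rewrite -[leRHS]mulr1 ler_wpM2l// ltW.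
by exists (`|v|^-1 *: v) => //=; rewrite normrZ normfV normr_id mulVf// gt_eqF.
Qed.

(** Without boundedness the supremum is [0] by convention. *)
Lemma opnorm_ge0 (K : {linear U -> V}) : 0 <= opnorm K.
Proof.
rewrite /opnorm; set A := [set _ | _ in _].
have [supA|/sup_out->//] := pselect (has_sup A).
apply: (@le_trans _ _ `|K 0|) => //.
by apply: sup_upper_bound => //; exists 0 => //=; rewrite normr0.
Qed.

Lemma diam_under_ub (K : {linear U -> V}) (X : set U) :
  bounded_near K (nbhs (0 : U)) -> compact X ->
  forall x y, X x -> X y -> `|K x - K y| <= diam_under K X.
Proof.
move=> bK /compact_bounded/ex_strict_bound_gt0 [M M0 XM] x y Xx Xy.
apply: sup_upper_bound; last by exists x => //; exists y.
split; first by exists `|K x - K y|, x => //; exists y.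
exists (opnorm K * (M + M)) => _ [u Xu [v Xv <-]].
rewrite -linearB (le_trans (opnorm_ub bK _))// ler_wpM2l ?opnorm_ge0//.
by rewrite (le_trans (ler_normB _ _))// lerD// ltW//; apply: XM.
Qed.

Lemma diam_ub (S : set V) : compact S ->
  forall x y, S x -> S y -> `|x - y| <= diam S.
Proof.
move=> /compact_bounded/ex_strict_bound_gt0 [M M0 XM] x y Sx Sy.
apply: sup_upper_bound; last by exists x => //; exists y.
split; first by exists `|x - y|, x => //; exists y.
exists (M + M) => _ [u Xu [v Xv <-]].
by rewrite (le_trans (ler_normB _ _))// lerD// ltW//; apply: XM.
Qed.

End Bounds.

(** * The energy of one iteration *)

Section Descent.
Context {R : realType} {U V : euclideanType R}.
Variables (chi : bool) (rho L nK : R) (y : V).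

(** Lyapunov function of the method relative to a primal solution and a
    multiplier [y]; [dx], [dk], [dw] stand for the errors of [x], [K x] and [w].
    The negative term, present for [chi = 1], comes from linearizing the penalty
    at the previous iterate. The [nK ^+ 2] part of the proximal weight dominates
    it, and at the start, where [dw = dk], it cancels the [dw] term. *)
Definition energy (dx : U) (dk dw yt : V) : R :=
  (L + chi%:R * rho * nK ^+ 2) / 2 * `|dx| ^+ 2
  - chi%:R * rho / 2 * `|dk| ^+ 2
  + rho / 2 * `|dw| ^+ 2 + (2 * rho)^-1 * `|yt - y| ^+ 2.

Lemma energy_ge0 (dx : U) (dk dw yt : V) :
  0 < rho -> 0 < L -> `|dk| <= nK * `|dx| -> 0 <= energy dx dk dw yt.
Proof.
move=> rho0 L0 dkx; rewrite /energy; apply: addr_ge0; last first.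
  by rewrite mulr_ge0 ?invr_ge0 ?sqr_ge0// ltW// mulr_gt0.
apply: addr_ge0; last by rewrite mulr_ge0 ?sqr_ge0// ltW// divr_gt0.
have sL : 0 <= L * `|dx| ^+ 2 by rewrite mulr_ge0 ?sqr_ge0// ltW.
case: chi; last by rewrite !mul0r; lra.
have : `|dk| ^+ 2 <= nK ^+ 2 * `|dx| ^+ 2.
  by rewrite -exprMn lerXn2r ?nnegrE// (le_trans _ dkx).
rewrite -(ler_pM2l rho0) !mul1r; lra.
Qed.

(** Adding the optimality conditions of the two subproblems leaves inner
    products of increments, which the polarization identity turns into
    differences of squared norms. They telescope except for squares of
    increments: the ones from the dual update and from the penalty cancel, the
    proximal term absorbs the curvature of [G] and, through [hK2], the
    linearization error of the penalty, and [hW] discards a square. *)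
Lemma energy_descent (g dx dx' : U) (dk dk' dw dw' yt : V) (Gx' Gs Fw' Fs : R) :
  0 < rho ->
  `|dk' - dk| <= nK * `|dx' - dx| ->
  0 <= - inner g dx' + chi%:R * rho * inner (dw - dk) dk'
       + (1 - chi%:R) * rho * inner (dw - dk') dk' - inner yt dk'
       - (L + chi%:R * rho * nK ^+ 2) * inner (dx' - dx) dx' ->
  Gx' - Gs <= inner g dx' + L / 2 * `|dx' - dx| ^+ 2 ->
  let y' := yt - rho *: (dw' - dk') in
  Fw' - Fs <= inner y' dw' ->
  (Gx' + Fw' - inner y (dw' - dk')) - (Gs + Fs) <=
  energy dx dk dw yt - energy dx' dk' dw' y'.
Proof.
move=> rho0 hK hx hG y' hF; rewrite /energy.
have yE : (2 * rho)^-1 * `|yt - y| ^+ 2 - (2 * rho)^-1 * `|y' - y| ^+ 2 =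
    inner (yt - y) (dw' - dk') - rho / 2 * `|dw' - dk'| ^+ 2.
  rewrite (addrAC yt) (normD_sq (yt - y)) normrN normrZ gtr0_norm// innerNr innerZr exprMn.
  by field; rewrite gt_eqF.
have hK2 : rho * `|dk' - dk| ^+ 2 <= rho * (nK ^+ 2 * `|dx' - dx| ^+ 2).
  by rewrite ler_wpM2l ?(ltW rho0)// -exprMn lerXn2r ?nnegrE// (le_trans _ hK).
have hW : 0 <= rho * `|dw - dk'| ^+ 2 by rewrite mulr_ge0 ?sqr_ge0// ltW.
have {}hF : Fw' - Fs <= inner yt dw' - rho * inner (dw' - dk') dw'.
  by move: hF; rewrite /y' [X in _ <= X -> _]innerDl innerNl innerZl.
move: yE; move: ((2 * rho)^-1 * `|yt - y| ^+ 2) => e1.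
move: ((2 * rho)^-1 * `|y' - y| ^+ 2) => e2.
move: hK2 hW hF hx hG; rewrite !norm_inner !innerE.
rewrite (innerC dk' dk) (innerC dw' dk') (innerC dw dk') (innerC dx' dx).
by case: chi => /=; lra.
Qed.
End Descent.

(** * Ergodic means *)

Section ErgodicMean.
Context {R : realType} {U : euclideanType R}.
Implicit Types (x : nat -> U) (t : nat).

(** Moving the mean towards the new point exhibits it as a point of a segment,
    which is what convexity of a set speaks about. *)
Lemma ergodic_meanS x t : (0 < t)%N ->
  ergodic_mean x t.+1 =
  ergodic_mean x t + t.+1%:R^-1 *: (x t.+2 - ergodic_mean x t).
Proof.
move=> t0; have tN0 : t%:R != 0 :> R by rewrite pnatr_eq0 -lt0n.
have t1N0 : t.+1%:R != 0 :> R by rewrite pnatr_eq0.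
rewrite /ergodic_mean big_nat_recr//= scalerDr scalerBr [RHS]addrCA [RHS]addrC.
congr (_ + _); rewrite -scaleNr !scalerA -scalerDl; congr (_ *: _).
by rewrite -natr1 in t1N0 *; field; rewrite tN0 t1N0.
Qed.

Lemma ergodic_mean_convex (X : set U) x t :
  convex_set (X : set (convex_lmodType U)) -> (0 < t)%N ->
  (forall i, (2 <= i < t.+2)%N -> X (x i)) -> X (ergodic_mean x t).
Proof.
move=> cX; case: t => // t _; elim: t => [|t IH] Xx.
  by rewrite /ergodic_mean big_nat1 invr1 scale1r; exact: Xx.
rewrite ergodic_meanS//; apply: convex_mem => //.
- by apply: IH => i /andP[i2 it]; apply: Xx; rewrite i2 ltnW.
- by apply: Xx; rewrite !ltnS leqnn.
- by rewrite invr_ge0 ler0n /= invf_le1 ?ltr0n// ler1n.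
Qed.

Lemma sum_ergodic_mean x t : (0 < t)%N ->
  \sum_(2 <= i < t.+2) (x i - ergodic_mean x t) = 0.
Proof.
move=> t0; rewrite sumrB sumr_const_nat subSS subn1 /= /ergodic_mean.
rewrite -scaler_nat scalerA divff ?scale1r ?subrr//.
by rewrite pnatr_eq0 -lt0n.
Qed.

End ErgodicMean.

(** * The iterates of the algorithm *)

Section Iterates.
Context {R : realType} {U V : euclideanType R}.
Variables (X : set U) (G : U -> R) (gradG : U -> U) (F : V -> R)
  (K : {linear U -> V}) (LG : R) (chi : bool) (rho : R)
  (alpha theta tau rhot eta : nat -> R) (N : nat)
  (x xag xmd : nat -> U) (w wag y yag : nat -> V).
Hypotheses (X_convex : convex_set (X : set (convex_lmodType U)))
  (G_convex : convex_function (X : set (convex_lmodType U)) G)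
  (F_convex : convex_function [set: convex_lmodType V] F)
  (K_bounded : bounded_near K (nbhs (0 : U)))
  (G_grad : gradient_on X G gradG)
  (G_smooth : forall x1 x2, X x1 -> X x2 ->
      G x2 - G x1 - inner (gradG x1) (x2 - x1) <= LG / 2 * `|x2 - x1| ^+ 2)
  (LG_gt0 : 0 < LG) (rho_gt0 : 0 < rho)
  (alphaE : forall t, alpha t = 1)
  (thetaE : forall t, theta t = rho)
  (tauE : forall t, tau t = rho)
  (rhotE : forall t, rhot t = rho)
  (etaE : forall t, eta t = LG + chi%:R * rho * opnorm K ^+ 2)
  (aadmm : is_AADMM X F K idfun 0 gradG chi alpha theta tau rhot eta N
             x xag xmd w wag y yag).

Lemma AADMM_mem t : (1 <= t <= N)%N -> X (x t).
Proof.
case: t => // -[_|t /andP[_ tN]]; first exact: AADMM_x1 aadmm.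
by case: (AADMM_x aadmm (t := t.+1)).
Qed.

Lemma AADMM_md t : (1 <= t < N)%N -> xmd t = x t.
Proof.
move=> /[dup] tN /(AADMM_xmd aadmm) ->.
by rewrite alphaE subrr scale0r add0r scale1r.
Qed.

Lemma AADMM_dual t : (1 <= t < N)%N ->
  y t.+1 = y t - rho *: (w t.+1 - K (x t.+1)).
Proof. by move=> /(AADMM_y aadmm) ->; rewrite rhotE subr0. Qed.

(** First-order optimality: the right-hand side is the derivative of the
    objective of the [x] subproblem in a direction [d] that stays in [X]. *)
Lemma AADMM_x_opt t d : (1 <= t < N)%N -> X (x t.+1 + d) ->
  0 <= inner (gradG (x t)) d - chi%:R * rho * inner (w t - K (x t)) (K d)
       - (1 - chi%:R) * rho * inner (w t - K (x t.+1)) (K d)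
       + inner (y t) (K d)
       + (LG + chi%:R * rho * opnorm K ^+ 2) * inner (x t.+1 - x t) d.
Proof.
move=> tN Xz; have := AADMM_x aadmm tN.
rewrite AADMM_md// thetaE etaE => argx.
apply: (argmin_variational
  (c := (1 - chi%:R) * rho / 2 * `|K d| ^+ 2
        + (LG + chi%:R * rho * opnorm K ^+ 2) / 2 * `|d| ^+ 2) X_convex argx Xz).
move=> s _; rewrite [x t.+1 + d - _]addrC addKr /= !subr0 (linearD K) (linearZ_LR K) /=.
rewrite le_eqVlt; apply/orP; left; apply/eqP.
move: (LG + _) (K d) (K (x t)) (K (x t.+1)) => e kd kx kx'.
rewrite !norm_inner !innerE (innerC kd (w t)) (innerC kd kx').
rewrite (innerC kx' (w t)) (innerC d (x t.+1)) (innerC d (x t)).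
rewrite (innerC (x t) (x t.+1)).
by field.
Qed.

(** The dual update makes [y t.+1] a subgradient of [F] at [w t.+1]: this is
    the optimality condition of the [w] subproblem. *)
Lemma AADMM_w_opt t v : (1 <= t < N)%N ->
  F (w t.+1) - F v <= inner (y t.+1) (w t.+1 - v).
Proof.
move=> tN; have argw := AADMM_w aadmm tN.
have [d ->] : exists d, v = w t.+1 + d by exists (v - w t.+1); rewrite addrC subrK.
have : 0 <= F (w t.+1 + d) - F (w t.+1) - inner (y t) d
            + rho * inner (w t.+1 - K (x t.+1)) d.
  apply: (argmin_variational (c := rho / 2 * `|d| ^+ 2) _ argw
    (z := w t.+1 + d)) => //.
  move=> s s01; have := convex_ineq F_convex (x := w t.+1) (y := w t.+1 + d) I I s01.
  rewrite [w t.+1 + d - _]addrC addKr /= !subr0 tauE.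
  move: (K (x t.+1)) => kx.
  rewrite !norm_inner !innerE (innerC d (w t.+1)) (innerC kx (w t.+1)) (innerC kx d).
  lra.
rewrite AADMM_dual// opprD addrA subrr add0r !innerE.
lra.
Qed.

Variables (xs : U) (u : V).
Hypothesis X_xs : X xs.

Let E t := energy chi rho LG (opnorm K) u (x t - xs) (K (x t) - K xs)
  (w t - K xs) (y t).

Lemma AADMM_descent t : (1 <= t < N)%N ->
  G (x t.+1) + F (w t.+1) - inner u (w t.+1 - K (x t.+1)) - (G xs + F (K xs))
  <= E t - E t.+1.
Proof.
move=> tN; have /andP[t1 tltN] := tN.
have Xt : X (x t) by apply: AADMM_mem; rewrite t1 ltnW.
have Xt1 : X (x t.+1) by apply: AADMM_mem.
(* errors are measured from [xs] and [K xs], which cancel in differences *)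
have subrBB (W : zmodType) (a b c : W) : (a - c) - (b - c) = a - b.
  by rewrite opprB addrA subrK.
rewrite /E [y t.+1]AADMM_dual// -(subrBB _ (w t.+1) _ (K xs)).
apply: (@energy_descent _ _ _ chi rho LG (opnorm K) u (gradG (x t))) => //.
- by rewrite !subrBB -linearB opnorm_ub.
- have := @AADMM_x_opt t (xs - x t.+1) tN.
  rewrite (addrC (x t.+1)) subrK => /(_ X_xs).
  rewrite -(opprB (x t.+1) xs) linearN linearB !subrBB !innerNr; lra.
- have := G_smooth Xt Xt1.
  have := gradient_ineq X_convex G_convex G_grad Xt X_xs.
  rewrite subrBB !innerE; lra.
- by rewrite !subrBB -AADMM_dual//; exact: AADMM_w_opt.
Qed.

Lemma AADMM_sum t : (1 <= t < N)%N ->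
  \sum_(2 <= i < t.+2)
    (G (x i) + F (w i) - inner u (w i - K (x i)) - (G xs + F (K xs))) <= E 1.
Proof.
move=> tN; apply: (@le_trans _ _ (E 1 - E t.+1)); last first.
  by rewrite gerBl energy_ge0// -linearB opnorm_ub.
case: t tN => // t; elim: t => [|t IH] tN.
  by rewrite big_nat1; exact: AADMM_descent.
rewrite big_nat_recr//=.
have := AADMM_descent tN; have := IH (ltnW tN); lra.
Qed.

End Iterates.

(** * The duality gap at the ergodic mean *)

(** The supremum defining the conjugate at a subgradient is attained at [z], so
    it is finite. *)
Lemma subgradient_dom_conj (R : realType) (V : euclideanType R) (F : V -> R)
    (z u : V) : (forall v, F z + inner u (v - z) <= F v) -> dom_conj F u.
Proof.
move=> Fu; rewrite /dom_conj /= (@le_lt_trans _ _ (inner u z - F z)%:E) ?ltry//.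
apply: ge_ereal_sup => _ [v _ <-]; rewrite lee_fin.
by have := Fu v; rewrite !innerE; lra.
Qed.

(** Both [G] and [F] are bounded below by affine functions that are exact at the
    mean, [G] by its gradient there and [F] by the subgradient [u]; averaging
    kills the linear parts. Thus the objective at [(m, K m)] is at most the mean
    of the Lagrangian values at multiplier [u], although [w i] and
    [K (x i)] differ in general. *)
Lemma gap_le_mean_gap (R : realType) (U V : euclideanType R)
    (X : set U) (G : U -> R) (gradG : U -> U) (F : V -> R) (K : {linear U -> V})
    (x : nat -> U) (w : nat -> V) (u : V) (fs : R) (t : nat) :
  convex_set (X : set (convex_lmodType U)) ->
  convex_function (X : set (convex_lmodType U)) G ->
  gradient_on X G gradG -> (0 < t)%N ->
  (forall i, (2 <= i < t.+2)%N -> X (x i)) ->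
  (forall v, F (K (ergodic_mean x t)) + inner u (v - K (ergodic_mean x t)) <= F v) ->
  t%:R * (G (ergodic_mean x t) + F (K (ergodic_mean x t)) - fs) <=
  \sum_(2 <= i < t.+2) (G (x i) + F (w i) - inner u (w i - K (x i)) - fs).
Proof.
move=> cX cG gG t0 Xx Fu.
have Xm := ergodic_mean_convex cX t0 Xx.
have s0 := sum_ergodic_mean x t0.
move: Xm s0 Fu; set m := ergodic_mean x t => Xm s0 Fu.
pose l z := inner (gradG m) z + inner u (K z).
(* the linear parts, centred at the mean, sum to zero *)
have l0 : \sum_(2 <= i < t.+2) l (x i - m) = 0.
  rewrite /l big_split /=.
  under eq_bigr do rewrite innerC.
  under [X in _ + X]eq_bigr do rewrite innerC.
  by rewrite -!inner_suml -linear_sum s0 linear0 !inner0l addr0.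
have -> : t%:R * (G m + F (K m) - fs) =
    \sum_(2 <= i < t.+2) (G m + F (K m) - fs + l (x i - m)).
  by rewrite big_split /= l0 addr0 sumr_const_nat subSS subn1 /= mulr_natl.
rewrite !big_nat; apply: ler_sum => i it.
have := gradient_ineq cX cG gG Xm (Xx i it).
have := Fu (w i); rewrite /l linearB !innerE; lra.
Qed.

Theorem theorem2p5 (R : realType) (U V : euclideanType R)
    (X : set U) (G : U -> R) (gradG : U -> U) (F : V -> R)
    (K : {linear U -> V}) (LG : R)
    (X_closed : closed X)
    (X_convex : convex_set (X : set (convex_lmodType U)))
    (G_convex : convex_function (X : set (convex_lmodType U)) G)
    (G_lsc : lower_semicontinuous_on X G)
    (F_convex : convex_function [set: convex_lmodType V] F)
    (F_lsc : lower_semicontinuous (fun w : V => (F w)%:E))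
    (K_bounded : bounded_near K (nbhs (0 : U)))
    (G_grad : gradient_on X G gradG)
    (gradG_cont : {within X, continuous gradG})
    (LG_gt0 : 0 < LG)
    (G_smooth : forall x1 x2, X x1 -> X x2 ->
      G x2 - G x1 - inner (gradG x1) (x2 - x1) <= LG / 2 * `|x2 - x1| ^+ 2)
    (ws : V) (xs : U) (ys : V)
    (opt : is_optimal X G F K idfun 0 ws xs)
    (saddle : is_saddle_point X G F K idfun 0 ws xs ys)
    (X_compact : compact X)
    (Y_compact : compact (dom_conj F))
    (chi : bool) (rho : R) (rho_gt0 : 0 < rho)
    (alpha theta tau rhot eta : nat -> R)
    (alphaE : forall t, alpha t = 1)
    (thetaE : forall t, theta t = rho)
    (tauE : forall t, tau t = rho)
    (rhotE : forall t, rhot t = rho)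
    (etaE : forall t, eta t = LG + chi%:R * rho * opnorm K ^+ 2)
    (N : nat) (x xag xmd : nat -> U) (w wag y yag : nat -> V)
    (aadmm : is_AADMM X F K idfun 0 gradG chi alpha theta tau rhot eta N
               x xag xmd w wag y yag)
    (y1_dom : dom_conj F (y 1))
    (t : nat) (t_bounds : (1 <= t < N)%N) :
  let fs := G xs + F ws in
  let DX := diam X in
  let DY := diam (dom_conj F) in
  let DXK := diam_under K X in
  let xbar := ergodic_mean x t in
  G xbar + F (K xbar) - fs <=
      LG / (2 * t%:R) * DX ^+ 2
      + chi%:R * rho / (2 * t%:R) * opnorm K ^+ 2 * DX ^+ 2
      + (1 - chi%:R) * rho / (2 * t%:R) * DXK ^+ 2
      + DY ^+ 2 / (2 * rho * t%:R)
  /\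
  (rho = DY / (chi%:R * opnorm K * DX + (1 - chi%:R) * DXK) ->
    G xbar + F (K xbar) - fs <=
      LG * DX ^+ 2 / (2 * t%:R)
      + (chi%:R * opnorm K * DX * DY + (1 - chi%:R) * DXK * DY) / t%:R).
Proof.
move=> fs DX DY DXK xbar.
have /andP[t0 tN] := t_bounds.
have [[Xxs wsE] _] := opt.
have {}wsE : ws = K xs by move: wsE => /eqP; rewrite subr_eq0 => /eqP.
have Xx i : (1 <= i <= N)%N -> X (x i) by exact: (AADMM_mem aadmm).
have t_gt0 : 0 < t%:R :> R by rewrite ltr0n.
(* the multiplier to compare with depends on the mean itself; compactness of
   the domain of the conjugate makes its distance to [y 1] harmless *)
have [u Fu] := subgradient_exists (K xbar) F_convex.
have Yu : dom_conj F u := subgradient_dom_conj Fu.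
have gap : t%:R * (G xbar + F (K xbar) - fs) <=
    energy chi rho LG (opnorm K) u (x 1 - xs) (K (x 1) - K xs)
      (w 1 - K xs) (y 1).
  rewrite /fs wsE; apply: le_trans (gap_le_mean_gap w _ X_convex G_convex G_grad _ _ Fu) _ => //.
    move=> i /andP[i2 it]; apply: Xx; rewrite (ltnW i2)/=.
    by rewrite (leq_trans _ tN).
  exact: (AADMM_sum X_convex G_convex F_convex K_bounded G_grad G_smooth
    LG_gt0 rho_gt0 alphaE thetaE tauE rhotE etaE aadmm).
have X1 : X (x 1) by exact: AADMM_x1 aadmm.
have y1 := AADMM_y1 aadmm; have w1 := AADMM_w1 aadmm; rewrite addr0 /= in w1.
have sqD (a b : R) : 0 <= a -> a <= b -> a ^+ 2 <= b ^+ 2.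
  by move=> a0 ab; rewrite lerXn2r ?nnegrE// (le_trans a0).
have hX : `|x 1 - xs| ^+ 2 <= DX ^+ 2 by apply: sqD => //; exact: diam_ub.
have hK : `|K (x 1) - K xs| ^+ 2 <= DXK ^+ 2.
  by apply: sqD => //; exact: diam_under_ub.
have hY : `|y 1 - u| ^+ 2 <= DY ^+ 2 by apply: sqD => //; exact: diam_ub.
set nK := opnorm K in gap *.
have bound : t%:R * (G xbar + F (K xbar) - fs) <=
    LG / 2 * DX ^+ 2 + chi%:R * rho / 2 * nK ^+ 2 * DX ^+ 2
    + (1 - chi%:R) * rho / 2 * DXK ^+ 2 + DY ^+ 2 / (2 * rho).
  apply: le_trans gap _; rewrite /energy w1.
  have h1 : (LG + chi%:R * rho * nK ^+ 2) / 2 * `|x 1 - xs| ^+ 2 <=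
            (LG + chi%:R * rho * nK ^+ 2) / 2 * DX ^+ 2.
    rewrite ler_wpM2l ?sqr_ge0// divr_ge0// addr_ge0 ?(ltW LG_gt0)//.
    by rewrite mulr_ge0 ?sqr_ge0// mulr_ge0 ?ler0n// ltW.
  have h2 : (1 - chi%:R) * rho / 2 * `|K (x 1) - K xs| ^+ 2 <=
            (1 - chi%:R) * rho / 2 * DXK ^+ 2.
    rewrite ler_wpM2l// divr_ge0// mulr_ge0 ?(ltW rho_gt0)//.
    by case: (chi); rewrite ?subrr ?subr0.
  have h3 : (2 * rho)^-1 * `|y 1 - u| ^+ 2 <= DY ^+ 2 / (2 * rho).
    by rewrite mulrC ler_wpM2r// invr_ge0 ltW// mulr_gt0.
  lra.
split.
  rewrite -(ler_pM2l t_gt0); apply: le_trans bound _.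
  rewrite le_eqVlt; apply/orP; left; apply/eqP.
  by field; rewrite !gt_eqF.
move=> rhoE.
(* a zero numerator or denominator would make [rho] zero *)
have DY0 : DY != 0.
  by apply/eqP => DY0; move: rho_gt0; rewrite rhoE DY0 mul0r ltxx.
have c0 : chi%:R * nK * DX + (1 - chi%:R) * DXK != 0.
  by apply/eqP => c0; move: rho_gt0; rewrite rhoE c0 invr0 mulr0 ltxx.
rewrite -(ler_pM2l t_gt0); apply: le_trans bound _.
rewrite rhoE le_eqVlt; apply/orP; left; apply/eqP.
move: c0; case: (chi) => /=;
  rewrite ?subrr ?subr0 !(mul0r, mul1r, add0r, addr0) => c0.
- move: c0; rewrite mulf_eq0 negb_or => /andP[nK0 DX0]; field.
  by rewrite (gt_eqF t_gt0) DX0 nK0 DY0.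
- by field; rewrite (gt_eqF t_gt0) c0 DY0.
Qed.
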